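(* For $\theta\in(0,\pi/2)$ let $c_1(\theta)=\tfrac12-\tfrac{\theta}{\pi}$, $c_2(\theta)=\tfrac{\cot\theta}{\pi-2\theta}$, and $$\mu_n(\theta)=-\sqrt{\frac{\log(nc_1(\theta))}{c_2(\theta)}},\qquad [\sigma_n(\theta)]^2=\frac{-\log\log 2}{2c_2(\theta)\big(\log(nc_1(\theta))-\log\log 2\big)}.$$ (1) For each $\theta\in(0,\pi/2)$ there exists an integer $n^*(\theta)$ such that for all $n\ge n^*(\theta)$, all $m\in\{1,\dots,n\}$, all $\rho\in(0,1]$ and all $\alpha\in(0,1]$, $$p^{\mathrm{G}}_{\mathrm{success}}(n,m,\alpha,\rho)\ge p^{\mathrm{G}}_{\mathrm{success}}(n,1,\alpha,\rho)\ge\Phi\!\left(\frac{\Phi^{-1}(\alpha)-\rho\,\mu_n(\theta)}{\sqrt{1-\rho^2+\rho^2[\sigma_n(\theta)]^2}}\right).$$ (2) Consequently, taking for each $\theta$ the least such integer $n^*(\theta)$ and setting $\Theta_n=\{\theta\in(0,\pi/2):n\ge n^*(\theta)\}$, for every $n\in\mathbb N$, $m\in\{1,\dots,n\}$, $\rho\in(0,1]$, $\alpha\in(0,1]$, $$p^{\mathrm{G}}_{\mathrm{success}}(n,m,\alpha,\rho)\ge p^{\mathrm{G}}_{\mathrm{success}}(n,1,\alpha,\rho)\ge\sup_{\theta\in\Theta_n}\Phi\!\left(\frac{\Phi^{-1}(\alpha)-\rho\,\mu_n(\theta)}{\sqrt{1-\rho^2+\rho^2[\sigma_n(\theta)]^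2}}\right).$$
   Context: Ordinal optimisation model: let $(Z_1,X_1),\dots,(Z_n,X_n)$ be i.i.d. copies of a pair $(Z,X)$ of real random variables. Order $Z_1,\dots,Z_n$ increasingly as $Z_{1:n}\le\dots\le Z_{n:n}$ and let $X_{\langle i\rangle}$ denote the $X$-value paired with $Z_{i:n}$. Let $x^*_\alpha$ be the $\alpha$-quantile of $X$. The success probability is $\Pr(\min_{1\le i\le m}X_{\langle i\rangle}\le x^*_\alpha)$. Gaussian copula model with correlation $\rho$: $Z,X$ have continuous marginal CDFs $F_Z,F_X$ and joint CDF $\boldsymbol\Phi_{\rho}(\Phi^{-1}(F_Z(z)),\Phi^{-1}(F_X(x)))$, with $\Phi$ the standard normal CDF and $\boldsymbol\Phi_\rho$ the standard bivariate normal CDF with correlation $\rho$. The success probability in this model is $p^{\mathrm{G}}_{\mathrm{success}}(n,m,\alpha,\rho)$. $\log$ is the natural logarithm. *)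

(* Defs.v *)
From HB Require Import structures.
From mathcomp Require Import all_boot all_order all_algebra.
From mathcomp Require Import all_classical all_reals all_analysis.
Set Implicit Arguments. Unset Strict Implicit. Unset Printing Implicit Defensive.
Import Order.TTheory GRing.Theory Num.Theory Num.Def.
Import numFieldNormedType.Exports.
Local Open Scope classical_set_scope.
Local Open Scope ring_scope.

Section defs.
Context {R : realType}.

Definition stdN : set R -> \bar R := normal_prob 0 1.

Definition PhiE (x : \bar R) : \bar R := stdN [set y : R | (y%:E <= x)%E].
Definition Phi (x : R) : R := fine (PhiE x%:E).

(** Phi^{-1} as the (generalized) quantile function, valued in \bar R:
    Phi^{-1}(a) = inf {x | a <= Phi x}; so Phi^{-1}(1) = +oo, Phi^{-1}(0) = -oo. *)
Definition Phi_inv (a : R) : \bar R :=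
  ereal_inf [set x%:E | x in [set x : R | a <= Phi x]].

(** Standard bivariate normal CDF with correlation rho (arguments in \bar R):
    the law of (U, rho U + sqrt(1-rho^2) V) with U, V i.i.d. N(0,1);
    this covers the degenerate case rho = 1 as well. *)
Definition Phi2 (rho : R) (a b : \bar R) : \bar R :=
  ((stdN \x stdN)%E
     [set p : R * R | (p.1%:E <= a)%E /\
                      ((rho * p.1 + Num.sqrt (1 - rho ^+ 2) * p.2)%:E <= b)%E]).

Definition quantile (F : R -> R) (alpha : R) : \bar R :=
  ereal_inf [set x%:E | x in [set x : R | alpha <= F x]].

(** 0-based rank of index i in the ordering of z (ties broken by index):
    rank z i = k  iff  z i is Z_{k+1:n}. *)
Definition rank (n : nat) (z : 'I_n -> R) (i : 'I_n) : nat :=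
  #|[set j : 'I_n | (z j < z i) || ((z j == z i) && (j < i)%N)]|.

Definition c1 (theta : R) : R := 2^-1 - theta / pi.
Definition c2 (theta : R) : R := (cos theta / sin theta) / (pi - 2 * theta).
Definition mu_n (n : nat) (theta : R) : R :=
  - Num.sqrt (ln (n%:R * c1 theta) / c2 theta).
Definition sigma2_n (n : nat) (theta : R) : R :=
  (- ln (ln 2)) / (2 * c2 theta * (ln (n%:R * c1 theta) - ln (ln 2))).

(** The lower bound Phi((Phi^{-1}(alpha) - rho mu_n)/sqrt(1-rho^2+rho^2 sigma_n^2)),
    computed in \bar R (so that Phi^{-1}(1) = +oo gives the value 1). *)
Definition bound (n : nat) (theta alpha rho : R) : \bar R :=
  PhiE ((Phi_inv alpha - (rho * mu_n n theta)%:E) *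
        ((Num.sqrt (1 - rho ^+ 2 + rho ^+ 2 * sigma2_n n theta))^-1)%:E)%E.

End defs.

Definition gauss_copula_model {R : realType} (d : measure_display)
  (T : measurableType d) (P : probability T R) (n : nat)
  (Z X : 'I_n -> T -> R) (FZ FX : R -> R) (rho : R) : Prop :=
  (forall i, measurable_fun setT (Z i)) /\
  (forall i, measurable_fun setT (X i)) /\
  continuous FZ /\ continuous FX /\
      (forall i z, P [set t | Z i t <= z] = (FZ z)%:E) /\
      (forall i x, P [set t | X i t <= x] = (FX x)%:E) /\
      (forall i z x, P [set t | Z i t <= z /\ X i t <= x] =
                     Phi2 rho (Phi_inv (FZ z)) (Phi_inv (FX x))) /\
      (forall A B : 'I_n -> set R,
         (forall i, measurable (A i)) -> (forall i, measurable (B i)) ->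
         P (\bigcap_(i in [set: 'I_n]) [set t | A i (Z i t) /\ B i (X i t)]) =
         (\prod_(i < n) P [set t | A i (Z i t) /\ B i (X i t)])%E).

(** Success event: min_{1<=i<=m} X_<i> <= x*_alpha, i.e. some pair whose Z
    has rank < m (0-based) has X below the alpha-quantile of X. *)
Definition success_event {R : realType} {T : Type} (n m : nat)
  (Z X : 'I_n -> T -> R) (xstar : \bar R) : set T :=
  [set t | exists i : 'I_n, (rank (fun j => Z j t) i < m)%N /\ ((X i t)%:E <= xstar)%E].

Definition p_success {R : realType} (d : measure_display) (T : measurableType d)
  (P : probability T R) (n m : nat) (Z X : 'I_n -> T -> R) (FX : R -> R)
  (alpha : R) : \bar R :=
  P (success_event m Z X (quantile FX alpha)).

Definition good {R : realType} (theta : R) (N : nat) : Prop :=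
  forall n : nat, (N <= n)%N ->
  forall m : nat, (1 <= m <= n)%N ->
  forall rho alpha : R, 0 < rho <= 1 -> 0 < alpha <= 1 ->
  forall (d : measure_display) (T : measurableType d) (P : probability T R)
         (Z X : 'I_n -> T -> R) (FZ FX : R -> R),
  gauss_copula_model P Z X FZ FX rho ->
  (p_success P 1 Z X FX alpha <= p_success P m Z X FX alpha)%E /\
  (bound n theta alpha rho <= p_success P 1 Z X FX alpha)%E.

Definition Theta_n {R : realType} (n : nat) : set R :=
  [set theta | 0 < theta < pi / 2 /\
     exists nstar : nat, [/\ good theta nstar,
                             (forall N, good theta N -> (nstar <= N)%N) &
                             (nstar <= n)%N]].

(* Main.v *)
(** Only large [n] matter, and for these it suffices to compare laws.  With
    Z = U and X = rho U + sqrt(1 - rho^2) V on the normal scale, the selected X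
    is rho U_(1) + sqrt(1 - rho^2) V with V independent of U_(1), whereas the
    bound is the value at Phi^{-1}(alpha) of the cdf of
    rho W + sqrt(1 - rho^2) V with W ~ N(mu_n, sigma_n^2).  So the bound follows
    once U_(1) is stochastically smaller than W, that is,
    Phi((c - mu_n) / sigma_n) <= 1 - (1 - Phi c)^n for all c.  For large n this
    holds because c2(theta) > 1/2: the Gaussian tail exp(-x^2/2) dominates
    exp(-c2 x^2), so n Phi(mu_n) grows like a power of n.

    Densities of order statistics are avoided by cutting the values of Z at the
    k/K-quantiles: the events "Z_i lies in the k-th cell, all other Z_j lie
    above it, X_i <= x" are disjoint boxes inside the success event, and the
    sum of their probabilities is a lower Riemann sum. *)
Require Import Defs.
From HB Require Import structures.
From mathcomp Require Import all_boot all_order all_algebra.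
From mathcomp Require Import all_classical all_reals all_analysis.
From mathcomp Require Import measurable_realfun ring lra.
Set Implicit Arguments. Unset Strict Implicit. Unset Printing Implicit Defensive.
Import Order.TTheory GRing.Theory Num.Theory Num.Def.
Import numFieldNormedType.Exports.
Local Open Scope classical_set_scope.
Local Open Scope ring_scope.

(** * The standard normal law: distribution function, tails, Gaussian averages *)

Section normal_law.
Context {R : realType}.
Implicit Types (m s x y c : R).
Local Notation leb := (@lebesgue_measure R).
Local Notation gam := (normal_prob (0 : R) 1).

(** The Radon-Nikodym derivative of the law agrees almost everywhere with [normal_pdf]: both have
    the same integral over every measurable set. *)
Lemma ge0_integral_normal_prob m s (f : R -> \bar R) : s != 0 ->
  measurable_fun setT f -> (forall x, 0 <= f x)%E ->
  (\int[normal_prob m s]_x f x = \int[leb]_x (f x * (normal_pdf m s x)%:E))%E.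
Proof.
move=> s0 mf f0.
have dom := normal_prob_dominates m s.
rewrite -(Radon_Nikodym_SigmaFinite.change_of_variables dom)//.
have iRN := Radon_Nikodym_SigmaFinite.f_integrable dom.
have mpdf : measurable_fun setT (fun x => (normal_pdf m s x)%:E).
  by apply/measurable_EFinP; exact: measurable_normal_pdf.
apply: ae_eq_integral => //.
- by apply: emeasurable_funM => //; exact: measurable_int iRN.
- exact: emeasurable_funM.
- apply: ae_eqe_mul2l; apply: integral_ae_eq => // E _ mE.
  by rewrite -Radon_Nikodym_SigmaFinite.f_integral.
Qed.

Lemma normal_pdf_val m s x : s != 0 -> normal_pdf m s x =
  normal_peak s * expR (- (x - m) ^+ 2 / (s ^+ 2 *+ 2)).
Proof. by move=> s0; rewrite normal_pdfE. Qed.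

Lemma normal_prob_affine m s c : 0 < s ->
  normal_prob m s `]-oo, c] = gam `]-oo, (c - m) / s].
Proof.
move=> s0; rewrite /normal_prob.
pose F (x : R^o) := (x - m) / s.
have F'E : F^`()%classic = cst s^-1.
  apply/funext => x; rewrite /F derive1E deriveM// deriveD// derive_cst scaler0.
  by rewrite add0r derive_id derive_cst addr0 scaler1.
have cF : continuous F.
  move=> x; apply: cvgM; last exact: cvg_cst.
  by apply: (@cvgB _ R^o) => //; exact: cvg_cst.
rewrite (@increasing_ge0_integration_by_substitutionNy _ F (normal_pdf 0 1) c).
- apply: eq_integral => x _; rewrite F'E; congr EFin.
  transitivity (normal_pdf 0 1 ((x - m) / s) * s^-1) => //.
  rewrite !normal_pdf_val ?oner_neq0 ?gt_eqF//= subr0 mulrAC; congr (_ * _).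
    rewrite /normal_peak expr1n mul1r -!mulrnAr sqrtrM ?sqr_ge0//.
    by rewrite sqrtr_sqr gtr0_norm// invfM mulrC.
  by congr expR; field; rewrite gt_eqF.
- by move=> x y _ _ xy; rewrite /F ltr_pM2r ?invr_gt0// ltrD2r.
- by move=> x _; rewrite F'E; exact: cvg_cst.
- by rewrite F'E; exact: is_cvg_cst.
- by rewrite F'E; exact: cvg_cst.
- split; last by apply: cvg_at_left_filter; exact: cF.
  by move=> x _; rewrite /F; exact: derivableM.
- by apply/gt0_cvgMlNy; [rewrite invr_gt0|exact: cvg_addrr_Ny].
- by apply: continuous_subspaceT; exact/continuous_normal_pdf/oner_neq0.
- by move=> x _; exact: normal_pdf_ge0.
Qed.

Lemma PhiE_EFin x : PhiE x%:E = (Phi x)%:E.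
Proof.
rewrite /Phi fineK// /PhiE /stdN.
have -> : [set y : R | (y%:E <= x%:E)%E] = `]-oo, x]%classic.
  by apply/seteqP; split => y /=; rewrite in_itv/= lee_fin.
exact: fin_num_measure.
Qed.

Lemma gam_itvNy x : gam `]-oo, x] = (Phi x)%:E.
Proof.
by rewrite -PhiE_EFin /PhiE /stdN; congr (normal_prob _ _ _).
Qed.

Lemma Phi_ge0 x : 0 <= Phi x.
Proof. by rewrite -lee_fin -gam_itvNy. Qed.

Lemma Phi_le1 x : Phi x <= 1.
Proof. by rewrite -lee_fin -gam_itvNy; exact: probability_le1. Qed.

Lemma Phi_le x y : x <= y -> Phi x <= Phi y.
Proof.
move=> xy; rewrite -lee_fin -!gam_itvNy le_measure ?inE//.
by apply: subset_itvl; rewrite bnd_simp.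
Qed.

Lemma Phi_min x y : Phi (minr x y) = minr (Phi x) (Phi y).
Proof.
case: (leP x y) => xy.
  by rewrite min_l// Phi_le.
by rewrite min_r// Phi_le// ltW.
Qed.

Lemma measurable_Phi : measurable_fun setT (@Phi R).
Proof. by apply: nondecreasing_measurable => // x y; exact: Phi_le. Qed.

Lemma gam_itvoc x y : x <= y -> gam `]x, y] = (Phi y - Phi x)%:E.
Proof.
move=> xy.
have -> : `]x, y]%classic = `]-oo, y]%classic `\` `]-oo, x]%classic.
  apply/seteqP; split => z /=; rewrite !in_itv/=.
    by move=> /andP[xz zy]; split => //; apply/negP; rewrite -ltNge.
  by move=> [-> /negP]; rewrite -ltNge => ->.
rewrite measureD//; last first.
  by rewrite (le_lt_trans (probability_le1 _ _))// ltry.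
have -> : `]-oo, y]%classic `&` `]-oo, x]%classic = `]-oo, x]%classic :> set R.
  apply/seteqP; split => z /=; rewrite !in_itv/=; first by case.
  by move=> zx; split => //; rewrite (le_trans zx).
by rewrite EFinB -!gam_itvNy.
Qed.

Lemma gam_itvoy x : gam `]x, +oo[ = (1 - Phi x)%:E.
Proof. by rewrite -setCitvl probability_setC// EFinB -gam_itvNy. Qed.

Lemma stdpdfE x : normal_pdf 0 1 x = normal_peak 1 * expR (- x ^+ 2 / 2).
Proof. by rewrite normal_pdf_val ?oner_neq0// subr0 expr1n. Qed.

Lemma Phi_lip x y : x <= y -> Phi y - Phi x <= normal_peak 1 * (y - x).
Proof.
move=> xy; rewrite -lee_fin -gam_itvoc// /normal_prob.
apply: (@le_trans _ _ (\int[leb]_(z in `]x, y]) (normal_peak 1)%:E)%E).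
  apply: ge0_le_integral => //.
  - by move=> z _; rewrite lee_fin normal_pdf_ge0.
  - by apply/measurable_EFinP/measurable_funTS; exact: measurable_normal_pdf.
  - by move=> z _; rewrite lee_fin normal_pdf_ub// oner_neq0.
rewrite integral_cst//= lebesgue_measure_itv/= lte_fin EFinM.
case: ltP => // yx.
by rewrite mule0 -EFinM lee_fin mulr_ge0 ?subr_ge0// normal_peak_ge0.
Qed.

Lemma continuous_Phi : continuous (@Phi R).
Proof.
have p0 : 0 < normal_peak (1 : R) by rewrite normal_peak_gt0// oner_neq0.
have lip x y : `|Phi x - Phi y| <= normal_peak 1 * `|x - y|.
  wlog xy : x y / x <= y.
    by move=> H; case: (leP x y) => [/H//|/ltW /H]; rewrite distrC (distrC y).
  rewrite distrC ger0_norm ?subr_ge0 ?Phi_le//.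
  by rewrite distrC ger0_norm ?subr_ge0// Phi_lip.
move=> x; apply/cvgrPdist_lt => e e0; near=> y.
rewrite (le_lt_trans (lip _ _))// -ltr_pdivlMl//.
by near: y; apply: cvgr_dist_lt => //; rewrite mulr_gt0// invr_gt0.
Unshelve. all: by end_near. Qed.

(** Within distance [|c| + 1] of 0 the density is at least its value at that distance. The unit
    intervals on either side of [c] then give crude lower bounds for both tails. *)
Let unit_itv_lb x c : (forall z, z \in `]x, x + 1] -> `|z| <= `|c| + 1) ->
  ((normal_peak 1 * expR (- (`|c| + 1) ^+ 2 / 2))%:E <= gam `]x, (x + 1)%R])%E.
Proof.
move=> H; rewrite /normal_prob.
have -> : (normal_peak 1 * expR (- (`|c| + 1) ^+ 2 / 2))%:E =
    (\int[leb]_(z in `]x, (x + 1)%R])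
      (normal_peak 1 * expR (- (`|c| + 1) ^+ 2 / 2))%:E)%E.
  rewrite integral_cst//= lebesgue_measure_itv/= lte_fin ltrDl ltr01.
  by rewrite -EFinD addrAC subrr add0r mule1.
apply: ge0_le_integral => //.
- by move=> z _; rewrite lee_fin mulr_ge0 ?normal_peak_ge0 ?expR_ge0.
- by apply/measurable_EFinP/measurable_funTS; exact: measurable_normal_pdf.
- move=> z xz; rewrite lee_fin stdpdfE ler_wpM2l ?normal_peak_ge0// ler_expR.
  rewrite ler_pM2r ?invr_gt0// lerN2 -real_normK ?num_real//.
  by rewrite ler_sqr ?nnegrE ?addr_ge0// H.
Qed.

Lemma Phi_lb c : normal_peak 1 * expR (- (`|c| + 1) ^+ 2 / 2) <= Phi c.
Proof.
rewrite -lee_fin -gam_itvNy.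
have := @unit_itv_lb (c - 1) c; rewrite subrK => /(_ _)/le_trans; apply.
  move=> z; rewrite in_itv/= => /andP[cz zc].
  have := ler_norm c; have := ler_norm (- c); rewrite normrN => c1 c2.
  by rewrite ler_norml; apply/andP; split; lra.
by rewrite le_measure ?inE//; apply: subset_itvr.
Qed.

Lemma Phi_ub c : normal_peak 1 * expR (- (`|c| + 1) ^+ 2 / 2) <= 1 - Phi c.
Proof.
rewrite -lee_fin -gam_itvoy.
apply: (le_trans (@unit_itv_lb c c _)).
  move=> z; rewrite in_itv/= => /andP[cz zc].
  have := ler_norm c; have := ler_norm (- c); rewrite normrN => c1 c2.
  by rewrite ler_norml; apply/andP; split; lra.
by rewrite le_measure ?inE//; apply: subset_itvl.
Qed.

(* Chernoff's bound by an exponential tilt: on either side of [c],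
   [x ^+ 2 >= c ^+ 2 + (x - c) ^+ 2], and the tilted density integrates to 1. *)
Let tail_ub c (I : set R) : measurable I -> (forall x, I x -> 0 <= c * (x - c)) ->
  (gam I <= (expR (- c ^+ 2 / 2))%:E)%E.
Proof.
move=> mI cI; rewrite /normal_prob.
apply: (@le_trans _ _ (\int[leb]_(x in I)
    ((expR (- c ^+ 2 / 2))%:E * (normal_pdf c 1 x)%:E))%E).
  apply: ge0_le_integral => //.
  - by move=> z _; rewrite lee_fin normal_pdf_ge0.
  - by apply/measurable_EFinP/measurable_funTS; exact: measurable_normal_pdf.
  - apply: emeasurable_funM => //.
    by apply/measurable_EFinP/measurable_funTS; exact: measurable_normal_pdf.
  - move=> x Ix; rewrite -EFinM lee_fin !normal_pdf_val ?oner_neq0//=.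
    rewrite mulrCA ler_wpM2l ?normal_peak_ge0// -expRD ler_expR.
    by rewrite subr0 expr1n; have := cI _ Ix; nra.
rewrite ge0_integralZl//.
- rewrite -[leRHS]mule1 lee_wpmul2l ?lee_fin ?expR_ge0//.
  have -> : (1 = \int[leb]_x (normal_pdf c 1 x)%:E)%E by rewrite integral_normal_pdf.
  apply: ge0_subset_integral => //.
    by apply/measurable_EFinP; exact: measurable_normal_pdf.
  by move=> x _; rewrite lee_fin normal_pdf_ge0.
- by apply/measurable_EFinP/measurable_funTS; exact: measurable_normal_pdf.
- by move=> x _; rewrite lee_fin normal_pdf_ge0.
Qed.

Lemma Phi_chernoff c : c <= 0 -> Phi c <= expR (- c ^+ 2 / 2).
Proof.
move=> c0; rewrite -lee_fin -gam_itvNy; apply: tail_ub => // x.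
by rewrite /= in_itv/= => xc; nra.
Qed.

Lemma PhiC_chernoff c : 0 <= c -> 1 - Phi c <= expR (- c ^+ 2 / 2).
Proof.
move=> c0; rewrite -lee_fin -gam_itvoy; apply: tail_ub => // x.
by rewrite /= in_itv/= andbT => xc; nra.
Qed.

(** For independent standard normal W and V, both sides are the probability that A W + s V <= B. In
    [f (v, y)], up to the cut at [Y], stands the conditional density at y of (A W + s V) / D given V
    = v. Tonelli exchanges the integrals; times the density of V it becomes the standard density in
    y times a normal density in v, which integrates to 1. *)
Lemma integral_Phi_affine (A s B : R) : 0 < A ->
  (\int[gam]_v (Phi ((B - s * v) / A))%:E =
   (Phi (B / Num.sqrt (A ^+ 2 + s ^+ 2)))%:E)%E.
Proof.
move=> A0; set D := Num.sqrt _; set Y := B / D.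
have DE : D ^+ 2 = A ^+ 2 + s ^+ 2.
  by rewrite sqr_sqrtr// addr_ge0// sqr_ge0.
have D0 : 0 < D by rewrite sqrtr_gt0 ltr_wpDr ?sqr_ge0// exprn_gt0.
have AD0 : 0 < A / D by rewrite divr_gt0.
pose f (p : R * R) : R :=
  (\1_`]-oo, Y] p.2 : R) * (normal_peak (A / D) *
     expR (- (p.2 - s * p.1 / D) ^+ 2 / ((A / D) ^+ 2 *+ 2))).
have mf : measurable_fun setT (EFin \o f).
  apply/measurable_EFinP; apply: measurable_funM.
    by apply: measurableT_comp => //; exact: measurable_indic.
  apply: measurable_funM => //; apply: measurableT_comp => //.
  apply: measurable_funM => //; apply: measurableT_comp => //.
  apply: measurable_funX => //; apply: measurable_funB => //.
  by apply: measurable_funM => //; exact: measurable_funM.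
have f0 p : (0 <= (EFin \o f) p)%E.
  by rewrite lee_fin !mulr_ge0 ?normal_peak_ge0 ?expR_ge0// indicE.
have LE v : (Phi ((B - s * v) / A))%:E = (\int[leb]_y (EFin \o f) (v, y))%E.
  have -> : (B - s * v) / A = (Y - s * v / D) / (A / D).
    by rewrite /Y; field; rewrite !gt_eqF.
  rewrite -gam_itvNy -normal_prob_affine// /normal_prob integral_mkcond.
  apply: eq_integral => y _; rewrite patchE /f/= indicE.
  case: ifPn => _; last by rewrite mul0r.
  by rewrite mul1r normal_pdf_val ?gt_eqF.
transitivity (\int[gam]_v \int[leb]_y (EFin \o f) (v, y))%E.
  by apply: eq_integral => v _; exact: LE.
transitivity (\int[leb]_y \int[gam]_v (EFin \o f) (v, y))%E.
  exact: (@fubini_tonelli _ _ (measurableTypeR R) (measurableTypeR R) R gam leb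
    (EFin \o f) mf f0).
rewrite -gam_itvNy [RHS]/normal_prob [RHS]integral_mkcond.
apply: eq_integral => y _.
rewrite ge0_integral_normal_prob ?oner_neq0//; last first.
  exact: (measurableT_comp mf (pair2_measurable y)).
transitivity (\int[leb]_v (((\1_`]-oo, Y] y : R) * normal_pdf 0 1 y)%:E *
   (normal_pdf (s * y / D) (A / D) v)%:E))%E.
  apply: eq_integral => v _; rewrite /f/= -!EFinM; congr EFin.
  rewrite !stdpdfE normal_pdf_val ?gt_eqF//.
  have mulACA (a b c d p q i : R) : a * b = c * d ->
      i * (p * a) * (q * b) = i * (q * c) * (p * d).
    by move=> abcd; transitivity (i * p * q * (a * b)); [ring|rewrite abcd; ring].
  apply: mulACA; rewrite -!expRD; congr expR.
  have -> : (A / D) ^+ 2 *+ 2 = A ^+ 2 * 2 / D ^+ 2 by field; rewrite gt_eqF.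
  (* Both sides equal D^2 (y^2 + v^2) - 2 D s y v, because D^2 = A^2 + s^2: this is the symmetric
     exponent of a bivariate normal density of correlation s / D. *)
  suff : D ^+ 2 * (y - s * v / D) ^+ 2 + A ^+ 2 * v ^+ 2 =
         D ^+ 2 * (v - s * y / D) ^+ 2 + A ^+ 2 * y ^+ 2.
    move=> H; apply: (@mulIf _ (A ^+ 2)); first by rewrite expf_neq0// gt_eqF.
    transitivity (- (D ^+ 2 * (y - s * v / D) ^+ 2 + A ^+ 2 * v ^+ 2) / 2).
      by field; rewrite !gt_eqF.
    by rewrite H; field; rewrite !gt_eqF.
  have -> : D ^+ 2 * (y - s * v / D) ^+ 2 = D ^+ 2 * y ^+ 2 - 2 * D * s * y * v + s ^+ 2 * v ^+ 2.
    by field; rewrite gt_eqF.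
  have -> : D ^+ 2 * (v - s * y / D) ^+ 2 = D ^+ 2 * v ^+ 2 - 2 * D * s * y * v + s ^+ 2 * y ^+ 2.
    by field; rewrite gt_eqF.
  by rewrite DE; ring.
rewrite ge0_integralZl//.
- rewrite integral_normal_pdf mule1 patchE indicE.
  by case: ifPn => _; rewrite ?mul1r ?mul0r.
- by apply/measurable_EFinP; exact: measurable_normal_pdf.
- by move=> x _; rewrite lee_fin normal_pdf_ge0.
- by rewrite lee_fin mulr_ge0 ?normal_pdf_ge0// indicE.
Qed.

End normal_law.

(** * Stochastic comparison of the normal minimum with N(mu_n, sigma_n^2) *)

Section comparison.
Context {R : realType}.
Implicit Types (x y c : R).
Local Notation p := (normal_peak (1 : R)).

Lemma onem_exp_le x (n : nat) : 0 <= x <= 1 -> (1 - x) ^+ n <= expR (- (n%:R * x)).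
Proof.
move=> /andP[x0 x1]; rewrite -mulrN expRM_natl lerXn2r ?nnegrE ?expR_ge0//.
  by rewrite subr_ge0.
exact: expR_ge1Dx.
Qed.

Lemma onem_expN_ge x : 0 <= x <= 1 -> x / 2 <= 1 - expR (- x).
Proof.
move=> /andP[x0 x1]; have := expR_ge1Dx x.
rewrite expRN => e1; have e0 : 0 < expR x by exact: expR_gt0.
have : (expR x)^-1 <= (1 + x)^-1 by rewrite lef_pV2 ?posrE//; lra.
have : (1 + x)^-1 <= 1 - x / 2.
  by rewrite -[leLHS]mul1r ler_pdivrMr; nra.
by move: (expR x)^-1 (1 + x)^-1 => u v; lra.
Qed.

(** The cubic term of the exponential series is already enough once [L] exceeds 6 K / b^3. *)
Lemma sqr_le_expR (b K : R) : 0 < b -> 0 < K ->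
  exists L0, forall L, L0 <= L -> K * L ^+ 2 <= expR (b * L).
Proof.
move=> b0 K0; exists (6 * K / b ^+ 3) => L LL.
have b30 : 0 < b ^+ 3 by rewrite exprn_gt0.
have L0 : 0 <= L by rewrite (le_trans _ LL)// divr_ge0 ?mulr_ge0 ?(ltW b30)// ltW.
have := @expR_ge1Dxn R (b * L) 2; rewrite mulr_ge0 ?(ltW b0)// => /(_ isT).
have -> : 3`!%:R = 6 :> R by [].
apply: le_trans; rewrite ler_wpDl//.
move: LL; rewrite ler_pdivrMr// => LL.
have -> : (b * L) ^+ 3 / 6 = L ^+ 2 * ((L * b ^+ 3) / 6) by field.
by rewrite mulrC ler_wpM2l ?sqr_ge0//; lra.
Qed.

(* Young's inequality for [(M + (t + 1)) ^+ 2]. *)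
Lemma Phi_lb_shift (d M t c : R) : 0 < d -> 0 <= M -> 0 <= t -> `|c| <= M + t ->
  p * expR (- ((1 + d) / 2 * M ^+ 2) - (1 + d^-1) / 2 * (t + 1) ^+ 2) <= Phi c.
Proof.
move=> d0 M0 t0 cMt; apply: le_trans (Phi_lb c).
rewrite ler_wpM2l ?normal_peak_ge0// ler_expR.
have c0 : 0 <= `|c| by [].
have H1 : (`|c| + 1) ^+ 2 <= (M + (t + 1)) ^+ 2.
  by rewrite ler_sqr ?nnegrE; lra.
have H2 : (M + (t + 1)) ^+ 2 <= (1 + d) * M ^+ 2 + (1 + d^-1) * (t + 1) ^+ 2.
  rewrite -subr_ge0.
  have -> : (1 + d) * M ^+ 2 + (1 + d^-1) * (t + 1) ^+ 2 - (M + (t + 1)) ^+ 2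
    = (d * M - (t + 1)) ^+ 2 / d by field; rewrite gt_eqF.
  by rewrite divr_ge0 ?sqr_ge0// ltW.
by lra.
Qed.

(** [Phi_ub] with (|x| + 1)^2 <= 2 (x^2 + 1); the constant [kp] carries the prefactor into the
    exponent. *)
Lemma PhiC_lb x (kp B : R) : `|ln p| <= kp -> x ^+ 2 <= B ->
  expR (- (B + 1 + kp)) <= 1 - Phi x.
Proof.
move=> pk xB; apply: le_trans (Phi_ub x).
have p0 : 0 < p by rewrite normal_peak_gt0// oner_neq0.
rewrite -{1}(lnK p0) -expRD ler_expR.
have : - ln p <= `|ln p| by rewrite -normrN ler_norm.
have : (`|x| + 1) ^+ 2 <= 2 * (B + 1).
  rewrite -(real_normK (num_real x)) in xB.
  by have := sqr_ge0 (`|x| - 1); nra.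
by lra.
Qed.

(** * The comparison for fixed parameters, in three ranges of [c] *)

Section regions.
(** Here [M] is to be -mu_n, [sg] is sigma_n, [T] its inverse square and [L] is ln (n c1). The
    parameter [d] is the slack in Young's inequality and [e] the exponent left over, so that n
    Phi(-M) is at least of order exp(e L). The conditions [C1] to [C5] express that [L] is large. *)
Variables (n : nat) (d e M L T sg c2 kp : R).
Let k := (1 + d^-1) / 2.
Let Q := 2 * (L / c2 + 1) * T + 1 + kp.
Hypotheses (d0 : 0 < d) (M0 : 0 <= M) (c20 : 0 < c2) (M2 : M ^+ 2 = L / c2).
Hypotheses (eE : e = 1 - (1 + d) / (2 * c2)) (nL : expR L <= n%:R).
Hypotheses (sg0 : 0 < sg) (T0 : T = (sg ^+ 2)^-1) (pk : `|ln p| <= kp).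
Hypotheses (C1 : 2 <= p * expR (e * L - 2 * k)) (C2 : 4 * k <= T) (C3 : 4 <= T).
Hypotheses (C4 : Q <= p * expR (e * L - 4 * k)) (C5 : 2 * Q <= expR L).

Let k0 : 0 < k.
Proof. by rewrite divr_gt0// addr_gt0// invr_gt0. Qed.

Let sgle : sg <= 2^-1.
Proof.
have s20 : 0 < sg ^+ 2 by rewrite exprn_gt0.
move: C3; rewrite T0 -[leRHS]mul1r ler_pdivlMr// => h.
by have := sg0; nra.
Qed.

Let div_sg c : (c / sg) ^+ 2 = c ^+ 2 * T.
Proof. by rewrite T0 exprMn exprVn. Qed.

(** The factor n supplies exp(L) and the Gaussian at distance M costs (1 + d) L / (2 c2) in the
    exponent; the difference is e L. *)
Let nPhi c t : 0 <= t -> `|c| <= M + t ->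
  p * expR (e * L - k * (t + 1) ^+ 2) <= n%:R * Phi c.
Proof.
move=> t0 cMt.
apply: (@le_trans _ _ (expR L * Phi c)); last by rewrite ler_wpM2r// Phi_ge0.
have := Phi_lb_shift d0 M0 t0 cMt; rewrite -/k => H.
have -> : p * expR (e * L - k * (t + 1) ^+ 2) = expR L *
   (p * expR (- ((1 + d) / 2 * M ^+ 2) - k * (t + 1) ^+ 2)).
  rewrite [RHS]mulrCA -expRD; congr (_ * expR _); rewrite M2 eE.
  by field; rewrite gt_eqF.
by rewrite ler_wpM2l ?expR_ge0.
Qed.

Let Phi01 c : 0 <= Phi c <= 1. Proof. by rewrite Phi_ge0 Phi_le1. Qed.

(** Let t be the distance of [c] below -M. By Chernoff the left side is at most w / 2 <= 1 -
    exp(-w), so w <= n Phi(c) suffices. The tail exp(-t^2 T / 2) of the narrow law is beaten by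
    exp(-2 k t^2) since 4 k <= T. *)
Let region_tail c : c <= - M - 2 * sg ->
  Phi ((c + M) / sg) <= 1 - (1 - Phi c) ^+ n.
Proof.
move=> cM; have [hM hs hs2 hT] : [/\ 0 <= M, 0 < sg, sg <= 2^-1 & 4 <= T] by [].
have [hk hT4] : 0 < k /\ 4 * k <= T by [].
set t := - c - M.
have t2 : 2 * sg <= t by rewrite /t; lra.
have t0 : 0 <= t by rewrite (le_trans _ t2)// mulr_ge0// ltW.
have cc : (c + M) / sg <= 0.
  by rewrite pmulr_lle0 ?invr_gt0//; rewrite /t in t0; lra.
apply: (le_trans (Phi_chernoff cc)).
have -> : - ((c + M) / sg) ^+ 2 / 2 = - (t ^+ 2 * T / 2).
  by rewrite div_sg /t; ring.
set w := 2 * expR (- (t ^+ 2 * T / 2)).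
have -> : expR (- (t ^+ 2 * T / 2)) = w / 2 by rewrite /w; field.
have w0 : 0 <= w by rewrite mulr_ge0// expR_ge0.
(* The cut at two standard deviations serves here: it forces w <= 1, as [onem_expN_ge] requires. *)
have tT : 4 <= t ^+ 2 * T.
  rewrite T0 ler_pdivlMr ?exprn_gt0//; have -> : 4 * sg ^+ 2 = (2 * sg) ^+ 2 by ring.
  by rewrite ler_sqr ?nnegrE// mulr_ge0// ltW.
have w1 : w <= 1.
  rewrite /w expRN ler_pdivrMr ?expR_gt0// mul1r.
  by have := expR_ge1Dx (t ^+ 2 * T / 2); lra.
apply: (@le_trans _ _ (1 - expR (- w))); first by apply: onem_expN_ge; rewrite w0.
rewrite lerB// (le_trans (onem_exp_le n (Phi01 c)))// ler_expR lerN2.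
have cMt : `|c| <= M + t by rewrite /t ler_norml; apply/andP; split; lra.
apply: le_trans (nPhi t0 cMt).
apply: (@le_trans _ _ (p * expR (e * L - 2 * k) * expR (- (2 * k * t ^+ 2)))).
  rewrite /w ler_pM ?expR_ge0// ler_expR lerN2.
  by rewrite mulrC -mulrA ler_wpM2l ?sqr_ge0//; lra.
rewrite -mulrA -expRD ler_wpM2l ?normal_peak_ge0// ler_expR.
by have := sqr_ge0 (t - 1); nra.
Qed.

(** Compare complements. As 2 sg <= 1, the point [c] lies above -(M + 1), hence (1 - Phi c)^n <=
    exp(-n Phi(-(M + 1))). The other complement is at least exp(-Q), and [C4] makes n Phi(-(M + 1))
    exceed Q. *)
Let region_mid c : - M - 2 * sg <= c -> c <= 1 ->
  Phi ((c + M) / sg) <= 1 - (1 - Phi c) ^+ n.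
Proof.
move=> cM c1; have [hM hs hs2 hT] : [/\ 0 <= M, 0 < sg, sg <= 2^-1 & 4 <= T] by [].
rewrite lerBrDr -lerBrDl.
apply: le_trans (PhiC_lb (B := 2 * (L / c2 + 1) * T) pk _); last first.
  rewrite div_sg; apply: ler_wpM2r; first by lra.
  rewrite -M2.
  have : 0 <= (M + 1 - (c + M)) * (c + M + M + 1) by apply: mulr_ge0; lra.
  by have := sqr_ge0 (M - 1); nra.
apply: (@le_trans _ _ (expR (- (n%:R * Phi (- (M + 1)))))); last first.
  rewrite ler_expR lerN2 (le_trans C4)//.
  have := @nPhi (- (M + 1)) 1; rewrite normrN ger0_norm ?addr_ge0//.
  move=> /(_ ler01 (lexx _)); apply: le_trans.
  by rewrite ler_wpM2l ?normal_peak_ge0// ler_expR; lra.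
apply: (@le_trans _ _ ((1 - Phi (- (M + 1))) ^+ n)); last exact: onem_exp_le.
rewrite lerXn2r ?nnegrE ?subr_ge0 ?Phi_le1// lerB// Phi_le//.
by lra.
Qed.

(** Both complements are now Gaussian in [c]: one is at most exp(-n c^2 / 2), the other at least
    exp(-Q c^2), and 2 Q <= n. *)
Let region_pos c : 1 <= c -> Phi ((c + M) / sg) <= 1 - (1 - Phi c) ^+ n.
Proof.
move=> c1; have [hM hs hs2 hT] : [/\ 0 <= M, 0 < sg, sg <= 2^-1 & 4 <= T] by [].
rewrite lerBrDr -lerBrDl.
apply: le_trans (PhiC_lb (B := 2 * (c ^+ 2 + L / c2) * T) pk _); last first.
  rewrite div_sg; apply: ler_wpM2r; first by lra.
  by rewrite -M2; have := sqr_ge0 (c - M); nra.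
have c0 : 0 <= c by lra.
apply: (@le_trans _ _ (expR (- c ^+ 2 / 2) ^+ n)).
  by rewrite lerXn2r ?nnegrE ?subr_ge0 ?Phi_le1 ?expR_ge0// PhiC_chernoff.
rewrite -expRM_natl ler_expR mulNr mulrN lerN2.
have kp0 : 0 <= kp by rewrite (le_trans _ pk).
have L0 : 0 <= L / c2 by rewrite -M2 sqr_ge0.
have c21 : 1 <= c ^+ 2 by rewrite -[leLHS](expr1n _ 2) ler_sqr ?nnegrE.
apply: (@le_trans _ _ (Q * c ^+ 2)).
  have h1 : 1 <= T by lra.
  rewrite /Q.
  have -> : (2 * (L / c2 + 1) * T + 1 + kp) * c ^+ 2 =
    2 * (c ^+ 2 + L / c2) * T + 1 + kp + (c ^+ 2 - 1) * (2 * (L / c2) * T + 1 + kp).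
    by ring.
  have LT0 : 0 <= L / c2 * T by rewrite mulr_ge0//; lra.
  by rewrite lerDl; apply: mulr_ge0; lra.
by have := ler_wpM2r (sqr_ge0 c) (le_trans C5 nL); lra.
Qed.

Lemma Phi_le_cdf_min c : Phi ((c + M) / sg) <= 1 - (1 - Phi c) ^+ n.
Proof.
case: (leP c (- M - 2 * sg)) => [/region_tail//|/ltW cM].
by case: (leP c 1) => [/(region_mid cM)//|/ltW/region_pos].
Qed.

End regions.

(* The strict inequality [1/2 < c2] is what makes the bound hold with room to
   spare for large [n]: up to the substitution [u = pi/2 - theta] it reads
   [u < tan u]. *)
Lemma c2_gt (theta : R) : 0 < theta < pi / 2 -> 2^-1 < c2 theta.
Proof.
move=> /andP[t0 t1].
have s0 : 0 < sin theta by apply: sin_gt0_pihalf; rewrite t0.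
have pt : 0 < pi - 2 * theta by lra.
rewrite /c2 ltr_pdivlMr// ltr_pdivlMr//.
pose u := pi / 2 - theta.
have u0 : 0 < u by rewrite /u; lra.
have -> : cos theta = sin u.
  by rewrite /u sinB sin_pihalf cos_pihalf mul1r mul0r subr0.
have -> : sin theta = cos u.
  by rewrite /u cosB sin_pihalf cos_pihalf mul1r mul0r add0r.
have -> : 2^-1 * (pi - 2 * theta) * cos u = u * cos u by rewrite /u; field.
pose f x := sin x - x * cos x : R.
have df x : is_derive x 1 f (x * sin x).
  by rewrite /f; apply: is_derive_eq; rewrite /GRing.scale/=; ring.
have cf : {within `[0, u], continuous f}.
  apply: continuous_subspaceT => x; apply: differentiable_continuous.
  by apply/derivable1_diffP; exact: ex_derive.
have [x xu] := MVT u0 (fun x _ => df x) cf.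
rewrite /f sin0 mul0r !subr0 => fE; rewrite -subr_gt0 fE.
move: xu; rewrite in_itv/= => /andP[x0 xu].
rewrite !mulr_gt0// sin_gt0_pihalf// x0/= (lt_trans xu)// /u.
by lra.
Qed.

Lemma Phi_le_cdf_min_near (theta : R) : 0 < theta < pi / 2 ->
  exists N : nat, forall n, (N <= n)%N -> [/\ (1 < n)%N, 0 < sigma2_n n theta &
    forall c, Phi ((c - mu_n n theta) / Num.sqrt (sigma2_n n theta)) <=
              1 - (1 - Phi c) ^+ n].
Proof.
move=> th; have /andP[t0 t1] := th.
have c2h := c2_gt th; have c20 : 0 < c2 theta by lra.
have c10 : 0 < c1 theta.
  by rewrite /c1 subr_gt0 ltr_pdivrMr ?pi_gt0//; lra.
have c11 : c1 theta <= 1.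
  have : 0 <= theta / pi by rewrite divr_ge0 ?pi_ge0// ltW.
  by rewrite /c1; lra.
have e1 : expR 1 > 2 :> R by have := @expR_gt1Dx R 1; rewrite oner_neq0 => /(_ isT); lra.
have ln20 : 0 < ln (2 : R) by apply: ln_gt0; lra.
have ln21 : ln (2 : R) < 1 by rewrite -[ltRHS]expRK ltr_ln ?posrE//; lra.
set a := - ln (ln (2 : R)).
have a0 : 0 < a by rewrite /a oppr_gt0 ln_lt0// ln20.
have [C CE] : exists C, c2 theta = C by exists (c2 theta).
rewrite CE in c2h c20.
(* This makes 1 + d the midpoint of 1 and 2 C, so that d > 0 and e > 0 both follow from C > 1/2. *)
pose d := (2 * C - 1) / 2.
have d0 : 0 < d by rewrite /d; lra.
pose e := 1 - (1 + d) / (2 * C).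
have e0 : 0 < e.
  by rewrite /e subr_gt0 ltr_pdivrMr; rewrite /d; lra.
pose k := (1 + d^-1) / 2.
have k0 : 0 < k by rewrite divr_gt0// addr_gt0// invr_gt0.
have p0 : 0 < p by rewrite normal_peak_gt0// oner_neq0.
pose kp := `|ln p|.
(* For L >= 1 both L / C + 1 and T are at most constant multiples of L; [K] collects the constants
   so that Q <= K L^2. *)
pose K := 2 * (C^-1 + 1) * (2 * C * (1 + a) / a) + 1 + kp.
have kp0 : 0 <= kp by exact: normr_ge0.
have K1 : 1 <= K.
  rewrite /K -addrA addrCA lerDl addr_ge0// mulr_ge0// ?mulr_ge0//.
  - by rewrite addr_ge0// invr_ge0 ltW.
  - exact: ltW.
  - by lra.
  - by rewrite invr_ge0 ltW.
have [L1 hL1] := @sqr_le_expR 1 (2 * K) ltr01 ltac:(lra).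
have [L2 hL2] := @sqr_le_expR e (2 * K / (p * expR (- (4 * k)))) e0
  ltac:(by rewrite divr_gt0 ?mulr_gt0 ?expR_gt0//; lra).
(* The thresholds [L1] and [L2] put 2 K L^2 below exp(L) and below p exp(e L - 4 k). The last entry
   makes T >= 4 k and T >= 4, because T >= 2 C L / a. *)
pose L0 := maxr 1 (maxr (maxr L1 L2) (maxr (4 * k) 4 * (a / (2 * C)))).
exists (truncn (expR L0 / c1 theta)).+2 => n Nn.
have nc : expR L0 <= n%:R * c1 theta.
  rewrite -ler_pdivrMr// (le_trans (ltW (truncnS_gt _)))// ler_nat.
  exact: (leq_trans _ Nn).
have nc0 : 0 < n%:R * c1 theta by rewrite (lt_le_trans _ nc)// expR_gt0.
set L := ln (n%:R * c1 theta).
have eL : expR L = n%:R * c1 theta by rewrite /L lnK.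
have : L0 <= L by rewrite -ler_expR eL.
rewrite /L0 !ge_max => /andP[L_1 /andP[/andP[/hL1 h1 /hL2 h2] hT]].
pose T := 2 * C * (L + a) / a.
have s2 : sigma2_n n theta = T^-1.
  by rewrite /sigma2_n CE -/L -/a /T invf_div.
have LT : L * (2 * C / a) <= T.
  have -> : L * (2 * C / a) = 2 * C * L / a by ring.
  by rewrite /T ler_pM2r ?invr_gt0// ler_pM2l ?mulr_gt0//; lra.
have T4 : maxr (4 * k) 4 <= T.
  apply: le_trans LT; rewrite -ler_pdivrMr ?divr_gt0 ?mulr_gt0//.
  by rewrite invf_div.
move: T4; rewrite ge_max => /andP[T4k T4].
have T0 : 0 < T by lra.
have TL : T <= 2 * C * (1 + a) / a * L.
  have -> : 2 * C * (1 + a) / a * L = 2 * C * ((1 + a) * L) / a by ring.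
  by rewrite /T ler_pM2r ?invr_gt0// ler_pM2l ?mulr_gt0//; nra.
have QK : 2 * (L / C + 1) * T + 1 + kp <= K * L ^+ 2.
  have C0 : 0 < C^-1 by rewrite invr_gt0.
  have hA : 2 * (L / C + 1) <= 2 * (C^-1 + 1) * L by nra.
  have hB : 2 * (L / C + 1) * T <=
      2 * (C^-1 + 1) * L * (2 * C * (1 + a) / a * L).
    by apply: ler_pM => //; [rewrite mulr_ge0// addr_ge0// divr_ge0//; lra|lra].
  have L21 : 1 <= L ^+ 2 by rewrite -[leLHS](expr1n _ 2) ler_sqr ?nnegrE//; lra.
  have := ler_wpM2l kp0 L21; rewrite /K.
  by lra.
split.
- exact: leq_trans Nn.
- by rewrite s2 invr_gt0.
- move=> c; rewrite s2 /mu_n CE -/L opprK.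
  have eM : p * expR (e * L - 4 * k) = expR (e * L) * (p * expR (- (4 * k))).
    by rewrite expRD; ring.
  have hQ : 2 * (K * L ^+ 2) <= p * expR (e * L - 4 * k).
    rewrite eM -ler_pdivrMr ?mulr_gt0 ?expR_gt0//.
    by move: h2; rewrite mulrAC mulrA.
  apply: (@Phi_le_cdf_min n d e _ L T _ C kp) => //.
  + by rewrite sqr_sqrtr// divr_ge0 ?(ltW c20)//; lra.
  + by rewrite eL ler_piMr.
  + by rewrite sqrtr_gt0 invr_gt0.
  + by rewrite sqr_sqrtr ?invrK// invr_ge0 ltW.
  + rewrite -/k; apply: (@le_trans _ _ (p * expR (e * L - 4 * k))).
      apply: le_trans hQ; rewrite ler_peMr//; have : 1 <= L ^+ 2; last by nra.
      by rewrite -[leLHS](expr1n _ 2) ler_sqr ?nnegrE//; lra.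
    by rewrite ler_wpM2l ?(ltW p0)// ler_expR; lra.
  + rewrite -/k (le_trans QK)//; apply: le_trans hQ.
    by have := sqr_ge0 L; nra.
  + apply: (@le_trans _ _ (2 * K * L ^+ 2)); first by lra.
    by move: h1; rewrite mul1r.
Qed.

End comparison.

(** * Quantiles of a continuous distribution function *)

Section continuous_cdf.
Context d (T : measurableType d) (R : realType) (P : probability T R).
Variables (X : T -> R) (F : R -> R).
Hypotheses (mX : measurable_fun setT X) (cF : continuous F).
Hypothesis (FE : forall x, P [set t | X t <= x] = (F x)%:E).

Let measurable_le x : measurable [set t | X t <= x].
Proof.
have -> : [set t | X t <= x] = setT `&` X @^-1` `]-oo, x].
  by rewrite setTI; apply/seteqP; split => t /=; rewrite in_itv.
exact: mX.
Qed.

Lemma cdf_le : {homo F : x y / x <= y}.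
Proof.
move=> x y xy; rewrite -lee_fin -!FE le_measure ?inE// => t /= /le_trans.
by apply.
Qed.

Lemma cdf_gt_measure x : P [set t | x < X t] = (1 - F x)%:E.
Proof.
have -> : [set t | x < X t] = ~` [set t | X t <= x].
  by apply/seteqP; split => t /=; rewrite ltNge => /negP.
by rewrite probability_setC// EFinB -FE.
Qed.

Let cdfE : cdf (P := P) (mfun_Sub (mem_set mX)) = EFin \o F.
Proof.
apply/funext => x; rewrite /cdf /distribution /pushforward/= -FE.
by congr (P _); apply/seteqP; split => t /=; rewrite in_itv.
Qed.

Lemma quantile_continuous_cdf alpha : 0 < alpha < 1 ->
  exists x, quantile F alpha = x%:E /\ F x = alpha.
Proof.
move=> /andP[a0 a1].
have [lo loP] : exists lo, F lo < alpha.
  have := @cvg_cdfNy0 _ _ _ P (mfun_Sub (mem_set mX)); rewrite cdfE.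
  move=> /fine_cvgP[_ /(@cvgr_lt _ _ _ _ _ _)/(_ _ a0)] h.
  by near (ninfty_nbhs R) => x; exists x; near: x; exact: h.
have [hi hiP] : exists hi, alpha < F hi.
  have := @cvg_cdfy1 _ _ _ P (mfun_Sub (mem_set mX)); rewrite cdfE.
  move=> /fine_cvgP[_ /(@cvgr_gt _ _ _ _ _ _)/(_ _ a1)] h.
  by near (pinfty_nbhs R) => x; exists x; near: x; exact: h.
have lohi : lo <= hi.
  by rewrite leNgt; apply/negP => /ltW/cdf_le; lra.
have [x0 _ Fx0] : exists2 x, x \in `[lo, hi] & F x = alpha.
  apply: IVT => //; first exact: continuous_subspaceT.
  by rewrite ge_min le_max (ltW loP) (ltW hiP) orbT.
pose S := [set x | alpha <= F x].
have S0 : S !=set0 by exists x0; rewrite /S/= Fx0.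
have lbS : has_lbound S.
  exists lo => x; rewrite /S/= => ax; rewrite leNgt; apply/negP => /ltW/cdf_le.
  by lra.
exists (inf S); split; first exact: ereal_inf_EFin.
apply/eqP; rewrite eq_le; apply/andP; split.
  by rewrite -[leRHS]Fx0 cdf_le//; apply: ge_inf => //; rewrite /S/= Fx0.
(* If F were below alpha at the infimum, continuity would keep it below on a ball, yet that ball
   contains points of [S]. *)
rewrite leNgt; apply/negP => Fl.
have := @cF (inf S); move=> /(@cvgr_lt _ _ _ _ _ _)/(_ _ Fl).
move=> /nbhs_ballP[e /= e0 He].
have [y Sy ye] := inf_adherent e0 (conj S0 lbS).
have : F y < alpha.
  apply: He; rewrite /ball/= distrC ger0_norm; first by lra.
  by rewrite subr_ge0; exact: ge_inf.
by move: Sy; rewrite /S/=; lra.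
Unshelve. all: by end_near. Qed.

(** The quantile at 1 may be infinite. It dominates the quantile at every a < 1, whose event has
    probability a; then a tends to 1. *)
Lemma prob_le_quantile1 :
  (1 <= P [set t | ((X t)%:E <= quantile F 1)%E])%E.
Proof.
have mq : measurable [set t | ((X t)%:E <= quantile F 1)%E].
  have mXE : measurable_fun setT (EFin \o X) by exact/measurable_EFinP.
  by have := mXE measurableT _ (emeasurable_itv `]-oo, quantile F 1]); rewrite setTI.
have lea a : 0 < a < 1 -> (a%:E <= P [set t | ((X t)%:E <= quantile F 1)%E])%E.
  move=> a01; have /andP[_ a1] := a01.
  have [x [qx <-]] := quantile_continuous_cdf a01.
  rewrite -FE le_measure ?inE// => t /= Xt.
  apply: (@le_trans _ _ x%:E); first by rewrite lee_fin.
  rewrite -qx; apply: ereal_inf_le_tmp => _ [y yS <-]; exists y => //.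
  exact: le_trans (ltW a1) yS.
apply/lee_addgt0Pr => e e0; rewrite -leeBlDr//.
case: (ltP e 1) => e1; first by rewrite -EFinB; apply: lea; lra.
by apply: (@le_trans _ _ 0%E) => //; rewrite -EFinB lee_fin subr_le0.
Qed.

End continuous_cdf.

(** * Finite disjoint families and lower Riemann sums *)

Lemma sum_measure_le_disjoint d (T : measurableType d) (R : realType)
    (mu : {measure set T -> \bar R}) (I : finType) (F : I -> set T) (E : set T) :
  (forall i, measurable (F i)) -> trivIset setT F -> measurable E ->
  (forall i, F i `<=` E) -> (\sum_(i : I) mu (F i) <= mu E)%E.
Proof.
move=> mF tF mE FE.
have -> : (\sum_(i : I) mu (F i) = \sum_(k < #|I|) mu (F (enum_val k)))%E.
  by rewrite -(big_enum_val (fun i => mu (F i)))/=; apply: eq_bigl.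
rewrite -(measure_bigsetU_ord mu xpredT (F := fun k => F (enum_val k)))//.
- apply: le_measure; rewrite ?inE//; first exact: bigsetU_measurable.
  by elim/big_ind : _ => [//|A B AE BE t [/AE|/BE]//|k _]; exact: FE.
- by move=> i j _ _ /tF h; apply: enum_val_inj; exact: h.
Qed.

Section riemann_sum.
Context {R : realType}.
Implicit Types (x y q : R).

Lemma expB_le x y n : 0 <= y -> y <= x ->
  x ^+ n.+1 - y ^+ n.+1 <= n.+1%:R * x ^+ n * (x - y).
Proof.
move=> y0 yx; have x0 : 0 <= x by exact: le_trans yx.
elim: n => [|n ih]; first by rewrite !expr1 expr0 !mul1r.
have xyn : y ^+ n.+1 <= x ^+ n.+1 by rewrite lerXn2r.
have -> : x ^+ n.+2 - y ^+ n.+2 =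
    x * (x ^+ n.+1 - y ^+ n.+1) + y ^+ n.+1 * (x - y).
  by rewrite (exprS x n.+1) (exprS y n.+1); ring.
have h1 := ler_wpM2l x0 ih.
have h2 : y ^+ n.+1 * (x - y) <= x ^+ n.+1 * (x - y).
  by rewrite ler_wpM2r ?subr_ge0.
apply: (le_trans (lerD h1 h2)).
have -> : n.+2%:R = n.+1%:R + 1 :> R by rewrite -natr1.
by rewrite [in leRHS](exprS x n); rewrite [in leLHS](exprS x n); lra.
Qed.

Lemma expB_le1 x y n : 0 <= y -> y <= x -> x <= 1 ->
  x ^+ n - y ^+ n <= n%:R * (x - y).
Proof.
move=> y0 yx x1; case: n => [|n]; first by rewrite !expr0 subrr mul0r.
apply: (le_trans (expB_le n y0 yx)); rewrite -mulrA ler_wpM2l//.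
rewrite ler_piMl ?subr_ge0// exprn_ile1//; exact: le_trans yx.
Qed.

(* The left-hand side is the increment over [[0, q]] of the cdf of the minimum
   of [m.+1] uniform variables, the sum a lower Riemann sum of its density. *)
Lemma cdf_min_le_riemann_sum (m K : nat) q : 0 <= q <= 1 ->
  1 - (1 - q) ^+ m.+1 <=
  \sum_(j < K) m.+1%:R * (1 - j.+2%:R / K.+2%:R) ^+ m *
     (minr (j.+2%:R / K.+2%:R) q - minr (j.+1%:R / K.+2%:R) q) +
  3 * m.+1%:R ^+ 2 / K.+2%:R.
Proof.
move=> /andP[q0 q1].
have K0 : 0 < K.+2%:R :> R by rewrite ltr0n.
pose h : R := K.+2%:R^-1.
have h0 : 0 < h by rewrite invr_gt0.
(* The grid runs from p 0 = h to p K = 1 - h: the levels 0 and 1 are left out because their normal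
   quantiles are infinite. *)
pose p (j : nat) : R := j.+1%:R * h.
pose u (j : nat) : R := minr (p j) q.
have pS j : p j.+1 = p j + h by rewrite /p -(natr1 j.+1); ring.
have p0 j : 0 <= p j by rewrite mulr_ge0// ltW.
have p1 j : (j < K.+2)%N -> p j <= 1.
  by move=> jK; rewrite /p ler_pdivrMr// mul1r ler_nat.
have u0 j : 0 <= u j by rewrite le_min p0.
have u1 j : u j <= 1 by rewrite ge_min q1 orbT.
set M : R := m.+1%:R.
have M1 : 1 <= M by rewrite ler1n.
(* Replacing the density M (1 - x)^m on a cell by its value at the right end costs at most M^2 h per
   unit length, and the cells have total length at most 1. *)
have step j : (j < K)%N -> (1 - u j) ^+ m.+1 - (1 - u j.+1) ^+ m.+1 <=
    M * (1 - p j.+1) ^+ m * (u j.+1 - u j) + M ^+ 2 * h * (u j.+1 - u j).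
  move=> jK; rewrite /u; case: (leP q (p j)) => qp.
    rewrite (min_r (x := p j.+1)); last by rewrite pS; lra.
    by rewrite !subrr !mulr0 addr0.
  rewrite -/(u j.+1).
  have pu : p j <= u j.+1 by rewrite le_min (ltW qp) pS andbT; lra.
  have pj1 : p j.+1 <= 1 by apply: p1; rewrite ltnS ltnW// ltnS ltnW.
  have H1 : (1 - p j) ^+ m.+1 - (1 - u j.+1) ^+ m.+1 <=
      M * (1 - p j) ^+ m * (u j.+1 - p j).
    have -> : u j.+1 - p j = (1 - p j) - (1 - u j.+1) by ring.
    by apply: expB_le; [rewrite subr_ge0|lra].
  apply: (le_trans H1); rewrite -mulrDl ler_wpM2r ?subr_ge0//.
  have H2 : (1 - p j) ^+ m - (1 - p j.+1) ^+ m <= m%:R * h.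
    have -> : h = (1 - p j) - (1 - p j.+1) by rewrite pS; ring.
    have := p0 j; have := pj1; rewrite pS => pj1h pj0.
    by apply: expB_le1; lra.
  have mM : m%:R <= M by rewrite ler_nat.
  have H3 : m%:R * h <= M * h by rewrite ler_wpM2r// ltW.
  have -> : M ^+ 2 * h = M * (M * h) by ring.
  by rewrite -mulrDr ler_wpM2l//; lra.
have sum_step : (1 - u 0%N) ^+ m.+1 - (1 - u K) ^+ m.+1 <=
    \sum_(j < K) M * (1 - p j.+1) ^+ m * (u j.+1 - u j) + M ^+ 2 * h.
  have := @telescope_sumr R 0 K (fun j => - (1 - u j) ^+ m.+1) (leq0n K).
  rewrite big_mkord opprK addrC => <-.
  have := @telescope_sumr R 0 K u (leq0n K); rewrite big_mkord => tel.
  apply: (@le_trans _ _ (\sum_(j < K) (M * (1 - p j.+1) ^+ m * (u j.+1 - u j) +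
      M ^+ 2 * h * (u j.+1 - u j)))).
    by apply: ler_sum => j _; rewrite opprK addrC; exact: step.
  rewrite big_split/= lerD2l -mulr_sumr tel ler_piMr//.
    by rewrite mulr_ge0 ?sqr_ge0// ltW.
  by have := u0 0%N; have := u1 K; lra.
(* [A1] and [A2] treat the parts of [0, q] below and above the grid. With the error of the sum they
   account for the constant 3. *)
have A1 : 1 - (1 - u 0%N) ^+ m.+1 <= M * h.
  have u0h : u 0%N <= h by rewrite ge_min /p mul1r lexx.
  rewrite -[X in X - _](expr1n _ m.+1).
  apply: le_trans (expB_le1 m.+1 _ _ _) _ => //.
  - by rewrite subr_ge0.
  - by have := u0 0%N; lra.
  - by rewrite ler_wpM2l//; lra.
have A2 : (1 - u K) ^+ m.+1 - (1 - q) ^+ m.+1 <= M * h.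
  have uq : u K <= q by rewrite ge_min lexx orbT.
  have qu : q - u K <= h.
    have pK : p K.+1 = 1 by rewrite /p /h mulfV// gt_eqF.
    have := pS K; rewrite pK => {}pK.
    by rewrite /u; case: (leP (p K) q) => h1; lra.
  apply: le_trans (expB_le1 m.+1 _ _ _) _ => //.
  - by rewrite subr_ge0.
  - by lra.
  - by have := u0 K; lra.
  - by rewrite ler_wpM2l//; lra.
have MM : M * h <= M ^+ 2 * h by rewrite ler_wpM2r ?(ltW h0)//; nra.
have -> : 3 * M ^+ 2 / K.+2%:R = 3 * (M ^+ 2 * h) by rewrite mulrA.
have -> : \sum_(j < K) M * (1 - j.+2%:R / K.+2%:R) ^+ m *
     (minr (j.+2%:R / K.+2%:R) q - minr (j.+1%:R / K.+2%:R) q) =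
   \sum_(j < K) M * (1 - p j.+1) ^+ m * (u j.+1 - u j) by [].
by lra.
Qed.

End riemann_sum.

(** * Cells in the plane of the two independent normals *)

Section cells.
Context {R : realType}.
Implicit Types (rho b u v : R).
Local Notation gam := (normal_prob (0 : R) 1).

(** The coordinates are U and V; the second condition is X <= b on the normal scale. *)
Definition cell rho b u v : set (R * R) :=
  [set p | u < p.1 <= v /\ rho * p.1 + Num.sqrt (1 - rho ^+ 2) * p.2 <= b].

Lemma measurable_half_plane (a c b : R) :
  measurable [set p : R * R | a * p.1 + c * p.2 <= b].
Proof.
have mf : measurable_fun setT (fun p : R * R => a * p.1 + c * p.2).
  by apply: measurable_funD; apply: measurable_funM.
have -> : [set p : R * R | a * p.1 + c * p.2 <= b] =
    setT `&` (fun p => a * p.1 + c * p.2) @^-1` `]-oo, b].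
  by rewrite setTI; apply/seteqP; split => p /=; rewrite in_itv.
exact: mf.
Qed.

Lemma measurable_quadrant rho b u :
  measurable [set p : R * R | (p.1%:E <= u%:E)%E /\
    ((rho * p.1 + Num.sqrt (1 - rho ^+ 2) * p.2)%:E <= b%:E)%E].
Proof.
have -> : [set p : R * R | (p.1%:E <= u%:E)%E /\
    ((rho * p.1 + Num.sqrt (1 - rho ^+ 2) * p.2)%:E <= b%:E)%E] =
    [set p | 1 * p.1 + 0 * p.2 <= u] `&`
    [set p | rho * p.1 + Num.sqrt (1 - rho ^+ 2) * p.2 <= b].
  by apply/seteqP; split => p /=; rewrite !lee_fin mul1r mul0r addr0.
by apply: measurableI; exact: measurable_half_plane.
Qed.

Lemma cellE rho b u v : cell rho b u v =
  [set p : R * R | (p.1%:E <= v%:E)%E /\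
    ((rho * p.1 + Num.sqrt (1 - rho ^+ 2) * p.2)%:E <= b%:E)%E] `\`
  [set p : R * R | (p.1%:E <= u%:E)%E /\
    ((rho * p.1 + Num.sqrt (1 - rho ^+ 2) * p.2)%:E <= b%:E)%E].
Proof.
apply/seteqP; split => p /=; rewrite !lee_fin.
  by move=> [/andP[up pv] pb]; split => // -[]; rewrite leNgt up.
move=> [[pv pb] np]; split => //; rewrite pv andbT ltNge.
by apply/negP => pu; apply: np.
Qed.

Lemma measurable_cell rho b u v : measurable (cell rho b u v).
Proof. by rewrite cellE; apply: measurableD; exact: measurable_quadrant. Qed.

(* [R] carries two structures of measurable type with the same measurable sets,
   its own and that of [measurableTypeR R], on which [normal_prob] is a measure;
   [Phi2] integrates with respect to the former. *)
Lemma ge0_integral_stdN (f : R -> \bar R) :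
  measurable_fun setT f -> (forall x, 0 <= f x)%E ->
  (\int[stdN]_x f x = \int[gam]_x f x)%E.
Proof.
move=> mf f0.
have mid : measurable_fun setT (id : measurableTypeR R -> R).
  by move=> _ Y mY; rewrite setTI.
have := @ge0_integral_pushforward _ _ _ _ R _ mid gam setT f measurableT mf.
by rewrite /= => <-.
Qed.

Lemma Phi2_EFin rho b u : Phi2 rho u%:E b%:E = (gam \x gam)%E
  [set p : R * R | (p.1%:E <= u%:E)%E /\
    ((rho * p.1 + Num.sqrt (1 - rho ^+ 2) * p.2)%:E <= b%:E)%E].
Proof.
rewrite /Phi2 /product_measure1.
apply: ge0_integral_stdN => [|x]; last exact: (measure_ge0 gam).
exact: (@measurable_fun_xsection _ _ (measurableTypeR R) (measurableTypeR R) R gam _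
  (measurable_quadrant rho b u)).
Qed.

Lemma measure_cell rho b u v : u <= v ->
  ((gam \x gam) (cell rho b u v) = Phi2 rho v%:E b%:E - Phi2 rho u%:E b%:E)%E.
Proof.
move=> uv; rewrite cellE measureD; last 3 first.
- exact: measurable_quadrant.
- exact: measurable_quadrant.
- apply: (@le_lt_trans _ _ 1%E); last exact: ltry.
  exact: (probability_le1 ((gam \x gam)%E : probability _ R) (measurable_quadrant rho b v)).
rewrite setIidr; first by rewrite !Phi2_EFin.
by move=> p /=; rewrite !lee_fin => -[pu pb]; split => //; exact: le_trans uv.
Qed.

(** The product measure integrates over U first-coordinate sections, whereas the comparison is made
    for V fixed; Tonelli on the indicator exchanges the two. *)
Lemma product_measure_ysection (C : set (R * R)) : measurable C ->
  ((gam \x gam) C = \int[gam]_v gam (ysection C v))%E.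
Proof.
move=> mC; transitivity (\int[gam]_x fubini_F gam (EFin \o \1_C) x)%E.
  by rewrite indic_fubini_tonelli_FE.
by rewrite (indic_fubini_tonelli gam gam mC) indic_fubini_tonelli_GE.
Qed.

(** For V = w fixed and rho > 0, the condition X <= b reads U <= c, so the section is the interval
    from min(u, c) to min(v, c). *)
Lemma gam_ysection_cell rho b u v (w : R) : 0 < rho -> u <= v ->
  let c := (b - Num.sqrt (1 - rho ^+ 2) * w) / rho in
  gam (ysection (cell rho b u v) w) =
    (minr (Phi v) (Phi c) - minr (Phi u) (Phi c))%:E.
Proof.
move=> rho0 uv c; rewrite -!Phi_min -gam_itvoc; last first.
  by rewrite le_min !ge_min uv lexx orbT.
congr (gam _); apply/seteqP; split => x /=.
  rewrite /ysection/= inE => -[/= /andP[ux xv] xb].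
  have xc : x <= c by rewrite ler_pdivlMr// mulrC; lra.
  by rewrite in_itv/= le_min xv xc gt_min ux.
rewrite /ysection/= inE in_itv/= le_min gt_min => /andP[h /andP[xv xc]].
split => /=; last by move: xc; rewrite ler_pdivlMr// mulrC; lra.
by rewrite xv andbT; move: h; rewrite (ltNge c) xc orbF.
Qed.

End cells.

(** * Ranks, measurability, and disjoint boxes in the success event *)

Section model.
Context {R : realType}.
Local Notation gam := (normal_prob (0 : R) 1).

Lemma rank_eq0 n (z : 'I_n -> R) i :
  (forall l, ~~ ((z l < z i) || ((z l == z i) && (l < i)%N))) -> rank z i = 0%N.
Proof.
by move=> zi; apply: eq_card0 => l; apply/negbTE/negP; rewrite inE/=; exact/negP.
Qed.

(** Ties are broken by index, so the least index among the minimisers has rank 0. *)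
Lemma exists_rank_eq0 n (z : 'I_n -> R) : (0 < n)%N -> exists i, rank z i = 0%N.
Proof.
move=> n0; case: (@arg_minP _ _ _ (Ordinal n0) xpredT z isT) => i _ zi.
case: (@arg_minnP _ i (fun l => z l == z i) val (eqxx _)) => k /eqP zk kmin.
exists k; apply: rank_eq0 => l; rewrite zk negb_or -leNgt zi//=.
by rewrite negb_and -leqNgt; case: eqP => //= /eqP/kmin.
Qed.

Lemma quantile_Phi (alpha : R) : 0 < alpha < 1 ->
  exists x, Phi_inv alpha = x%:E /\ Phi x = alpha.
Proof.
move=> a01; apply: (@quantile_continuous_cdf _ _ R gam id (@Phi R)) => //.
- exact: continuous_Phi.
- move=> x; rewrite -gam_itvNy; congr (gam _).
Qed.

Section rank_measurable.
Context d (T : measurableType d) n (Z X : 'I_n -> T -> R).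
Hypotheses (mZ : forall i, measurable_fun setT (Z i)).
Hypotheses (mX : forall i, measurable_fun setT (X i)).

Lemma measurable_rank_lt i m : measurable [set t | (rank (fun j => Z j t) i < m)%N].
Proof.
pose B l := [set t | (Z l t < Z i t) || ((Z l t == Z i t) && (l < i)%N)].
have mB l : measurable (B l).
  have : measurable_fun setT (fun t => (Z l t < Z i t) || ((Z l t == Z i t) && (l < i)%N)).
    apply: measurable_or; first exact: measurable_fun_ltr.
    by apply: measurable_and => //; exact: measurable_fun_eqr.
  by move=> /(_ measurableT [set true]); rewrite setTI; apply.
have rE t : (rank (fun j => Z j t) i)%:R = \sum_(l < n) \1_(B l) t :> R.
  rewrite /rank -sum1_card natr_sum big_mkcond/=; apply: eq_bigr => l _.
  rewrite indicE.
  have -> : (t \in B l) = (l \in in_set [set j | (Z j t < Z i t) || (Z j t == Z i t) && (j < i)%N]).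
    by apply/idP/idP; rewrite !inE.
  by case: ifP.
have mf : measurable_fun setT (fun t => \sum_(l < n) (\1_(B l) t : R)).
  by apply: measurable_sum => l; exact: measurable_indic.
have -> : [set t | (rank (fun j => Z j t) i < m)%N] =
    setT `&` (fun t => \sum_(l < n) (\1_(B l) t : R)) @^-1` `]-oo, m%:R[.
  by rewrite setTI; apply/seteqP; split => t /=; rewrite in_itv/= -rE ltr_nat.
exact: mf.
Qed.

Lemma measurable_success_event m (xs : \bar R) : measurable (success_event m Z X xs).
Proof.
have -> : success_event m Z X xs = \bigcup_(i in [set: 'I_n])
    ([set t | (rank (fun j => Z j t) i < m)%N] `&` [set t | ((X i t)%:E <= xs)%E]).
  by apply/seteqP; split => t; [move=> [i it]; exists i|move=> [i _ it]; exists i].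
apply: fin_bigcup_measurable; first exact: finite_finset.
move=> i _; apply: measurableI; first exact: measurable_rank_lt.
have mXE : measurable_fun setT (EFin \o X i) by exact/measurable_EFinP.
have := mXE measurableT _ (emeasurable_itv `]-oo, xs]).
by rewrite setTI.
Qed.

End rank_measurable.

Section copula.
Context d (T : measurableType d) (P : probability T R) (m : nat).
Variables (Z X : 'I_m.+1 -> T -> R) (FZ FX : R -> R) (rho : R).
Hypothesis mdl : gauss_copula_model P Z X FZ FX rho.
Variables (xs b : R).
Hypothesis xsb : Phi_inv (FX xs) = b%:E.

Let mZ i : measurable_fun setT (Z i).
Proof. by case: mdl. Qed.

Let mX i : measurable_fun setT (X i).
Proof. by case: mdl => _ []. Qed.

Let FZE i z : P [set t | Z i t <= z] = (FZ z)%:E.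
Proof. by case: mdl => _ [_ [_ [_ [h _]]]]. Qed.

Let cFZ : continuous FZ.
Proof. by case: mdl => _ [_ [h _]]. Qed.

Let jointE i z x : P [set t | Z i t <= z /\ X i t <= x] =
  Phi2 rho (Phi_inv (FZ z)) (Phi_inv (FX x)).
Proof. by case: mdl => _ [_ [_ [_ [_ [_ [h _]]]]]]. Qed.

Let indep (A B : 'I_m.+1 -> set R) :
  (forall i, measurable (A i)) -> (forall i, measurable (B i)) ->
  P (\bigcap_(i in [set: 'I_m.+1]) [set t | A i (Z i t) /\ B i (X i t)]) =
  (\prod_(i < m.+1) P [set t | A i (Z i t) /\ B i (X i t)])%E.
Proof. by case: mdl => _ [_ [_ [_ [_ [_ [_ h]]]]]]; exact: h. Qed.

Let measurable_box i (A B : set R) : measurable A -> measurable B ->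
  measurable [set t | A (Z i t) /\ B (X i t)].
Proof.
move=> mA mB; have := measurableI _ _ (mZ i measurableT mA) (mX i measurableT mB).
by rewrite !setTI.
Qed.

(** A difference of two values of the joint distribution function, which the copula expresses
    through [Phi2] at the normal scores [u] and [u']. *)
Let prob_cell i z z' u u' : z <= z' -> u <= u' ->
  Phi_inv (FZ z) = u%:E -> Phi_inv (FZ z') = u'%:E ->
  P [set t | `]z, z']%classic (Z i t) /\ `]-oo, xs]%classic (X i t)] =
  ((gam \x gam) (cell rho b u u'))%E.
Proof.
move=> zz uu zu zu'.
have -> : [set t | `]z, z']%classic (Z i t) /\ `]-oo, xs]%classic (X i t)] =
  [set t | Z i t <= z' /\ X i t <= xs] `\` [set t | Z i t <= z /\ X i t <= xs].
  apply/seteqP; split => t /=; rewrite !in_itv/=.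
    by move=> [/andP[h1 h2] h3]; split => // -[]; rewrite leNgt h1.
  move=> [[h1 h2] h3]; split => //; rewrite h1 andbT ltNge.
  by apply/negP => h; apply: h3.
have mQ y : measurable [set t | Z i t <= y /\ X i t <= xs].
  have := @measurable_box i `]-oo, y]%classic `]-oo, xs]%classic (measurable_itv _) (measurable_itv _).
  by congr measurable; apply/seteqP; split => t /=; rewrite !in_itv.
rewrite measureD//; last by rewrite (le_lt_trans (probability_le1 _ _)) ?ltry.
rewrite measure_cell// -xsb -zu -zu' -!(jointE i); congr (_ - P _)%E.
apply/seteqP; split => t /=; first by case.
by move=> [h1 h2]; split => //; split => //; exact: le_trans zz.
Qed.

Lemma riemann_sum_le_success (K : nat) : exists u : nat -> R,
  [/\ forall j, (j <= K)%N -> Phi (u j) = j.+1%:R / K.+2%:R,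
      forall j, (j < K)%N -> u j <= u j.+1 &
  (\sum_(j < K) (m.+1%:R * (1 - j.+2%:R / K.+2%:R) ^+ m)%:E *
     (gam \x gam) (cell rho b (u j) (u j.+1)) <=
   P (success_event 1 Z X xs%:E))%E].
Proof.
pose p (j : nat) : R := j.+1%:R / K.+2%:R.
have p01 j : (j <= K)%N -> 0 < p j < 1.
  by move=> jK; rewrite /p divr_gt0//= ltr_pdivrMr// mul1r ltr_nat !ltnS.
have pS j : p j < p j.+1 by rewrite /p ltr_pM2r ?invr_gt0// ltr_nat.
(* The [z j] are quantiles of Z and the [u j] below their normal scores, both at level (j + 1) / (K
   + 2); the value 0 for j > K is a default. *)
have [z zP] : {z : nat -> R & forall j, (j <= K)%N -> FZ (z j) = p j}.
  apply: (@choice _ _ (fun j y => (j <= K)%N -> FZ y = p j)) => j.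
  case: (leqP j K) => jK; last by exists 0.
  by have [y [_ yE]] := quantile_continuous_cdf (mZ ord0) cFZ (FZE ord0) (p01 _ jK); exists y.
have [u uP] : {u : nat -> R & forall j, (j <= K)%N ->
    Phi_inv (p j) = (u j)%:E /\ Phi (u j) = p j}.
  apply: (@choice _ _ (fun j y => (j <= K)%N ->
    Phi_inv (p j) = y%:E /\ Phi y = p j)) => j.
  case: (leqP j K) => jK; last by exists 0.
  by have [y yE] := quantile_Phi (p01 _ jK); exists y.
have uS j : (j < K)%N -> u j <= u j.+1.
  move=> jK; rewrite leNgt; apply/negP => /ltW/Phi_le.
  by rewrite (uP j (ltnW jK)).2 (uP _ jK).2 leNgt pS.
have zS j : (j < K)%N -> z j <= z j.+1.
  move=> jK; rewrite leNgt; apply/negP => /ltW/(cdf_le (mZ ord0) (FZE ord0)).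
  by rewrite (zP j (ltnW jK)) (zP _ jK) leNgt pS.
have zle i j : (i <= j)%N -> (j <= K)%N -> z i <= z j.
  move=> /subnK <-; elim: (j - i)%N => [//|k ih] kK.
  by rewrite (le_trans (ih (ltnW kK)))// zS.
exists u; split => //; first by move=> j jK; exact: (uP _ jK).2.
(* The pair [ji] holds the cell and the index of the observation in it. All other observations lie
   strictly above the cell, with X unconstrained. *)
pose A (ji : 'I_K * 'I_m.+1) (l : 'I_m.+1) : set R :=
  if l == ji.2 then `]z ji.1, z ji.1.+1]%classic else `]z ji.1.+1, +oo[%classic.
pose B (ji : 'I_K * 'I_m.+1) (l : 'I_m.+1) : set R :=
  if l == ji.2 then `]-oo, xs]%classic else setT.
have mA ji l : measurable (A ji l) by rewrite /A; case: ifP.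
have mB ji l : measurable (B ji l) by rewrite /B; case: ifP.
pose E ji := \bigcap_(l in [set: 'I_m.+1]) [set t | A ji l (Z l t) /\ B ji l (X l t)].
have EZ ji t : E ji t -> z ji.1 < Z ji.2 t <= z ji.1.+1.
  by move=> /(_ ji.2 I)[]; rewrite /A eqxx/= in_itv.
have EX ji t : E ji t -> X ji.2 t <= xs.
  by move=> /(_ ji.2 I)[_]; rewrite /B eqxx/= in_itv.
have EN ji t l : E ji t -> l != ji.2 -> z ji.1.+1 < Z l t.
  by move=> /(_ l I)[+ _] li; rewrite /A (negbTE li)/= in_itv/= andbT.
have PE ji : P (E ji) = (((1 - p ji.1.+1) ^+ m)%:E *
    (gam \x gam)%E (cell rho b (u ji.1) (u ji.1.+1)))%E.
  have jK : (ji.1 < K)%N by [].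
  rewrite /E indep// (bigD1 ji.2)//= muleC; congr (_ * _)%E.
    rewrite (eq_bigr (fun _ => (1 - p ji.1.+1)%:E)); last first.
      move=> l li; rewrite /A /B (negbTE li).
      rewrite -(zP _ jK) -(cdf_gt_measure (mZ l) (FZE l)).
      by congr (P _); apply/seteqP; split => t /=; rewrite in_itv/= andbT => // -[].
    by rewrite prodEFin prodr_const cardC1 card_ord.
  rewrite /A /B eqxx; apply: prob_cell; rewrite ?zS ?uS//.
  - by rewrite (zP _ (ltnW jK)) (uP _ (ltnW jK)).1.
  - by rewrite (zP _ jK) (uP _ jK).1.
(* For a given cell the m + 1 choices of the index have equal probabilities, whence the factor m +
   1. *)
have -> : (\sum_(j < K) (m.+1%:R * (1 - j.+2%:R / K.+2%:R) ^+ m)%:E *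
     (gam \x gam) (cell rho b (u j) (u j.+1)) = \sum_(ji : 'I_K * 'I_m.+1) P (E ji))%E.
  rewrite -(pair_bigA _ (fun j i => P (E (j, i))))/=; apply: eq_bigr => j _.
  rewrite (eq_bigr (fun _ => (((1 - p j.+1) ^+ m)%:E *
    (gam \x gam)%E (cell rho b (u j) (u j.+1)))%E)); last by move=> i _; rewrite PE.
  rewrite -(@fineK _ ((gam \x gam)%E _)); last first.
    exact: (fin_num_measure ((gam \x gam)%E : probability _ R) _ (measurable_cell _ _ _ _)).
  rewrite (eq_bigr (fun _ => ((1 - p j.+1) ^+ m *
    fine ((gam \x gam)%E (cell rho b (u j) (u j.+1))))%:E)); last by move=> i _; rewrite EFinM.
  by rewrite -EFinM sumEFin sumr_const card_ord -[X in _ = X%:E]mulr_natl mulrA.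
apply: sum_measure_le_disjoint.
- by move=> ji; apply: fin_bigcap_measurable => // l _; exact: measurable_box.
(* For distinct indices each Z-value would lie strictly above the other; for equal indices the cells
   themselves are disjoint. *)
- move=> [j i] [j' i'] _ _ [t [h h']].
  have [ii|ii] := eqVneq i i'; last first.
    have := EN _ _ _ h' ii; have := EZ _ _ h => /= /andP[_ h1] h2.
    rewrite eq_sym in ii.
    have := EN _ _ _ h ii; have := EZ _ _ h' => /= /andP[_ h3] h4.
    have := le_lt_trans h1 h4.
    by rewrite ltNge (ltW (le_lt_trans h3 h2)).
  subst i'; congr (_, _); apply/val_inj/eqP; rewrite eqn_leq /= leqNgt [(j' <= j)%N]leqNgt.
  have := EZ _ _ h => /= /andP[h1 h2]; have := EZ _ _ h' => /= /andP[h3 h4].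
  apply/andP; split; apply/negP => jj.
    by have := zle _ _ jj (ltnW (ltn_ord j)); lra.
  by have := zle _ _ jj (ltnW (ltn_ord j')); lra.
- exact: measurable_success_event.
- move=> ji t h; exists ji.2; split; last by rewrite lee_fin; exact: EX.
  rewrite (rank_eq0 (z := fun l => Z l t))// => l.
  have [->|li] := eqVneq l ji.2; first by rewrite ltxx ltnn andbF.
  have /andP[_ h1] := EZ _ _ h; have h2 := le_lt_trans h1 (EN _ _ _ h li).
  by rewrite negb_or -leNgt ltW//= negb_and (gt_eqF h2).
Qed.

End copula.
End model.

(** * The lower bound on the success probability *)

Section lower_bound.
Context {R : realType} d (T : measurableType d) (P : probability T R) (n : nat).
Variables (Z X : 'I_n -> T -> R) (FZ FX : R -> R) (rho : R).
Hypothesis mdl : gauss_copula_model P Z X FZ FX rho.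
Hypothesis rho01 : 0 < rho <= 1.
Local Notation gam := (normal_prob (0 : R) 1).

Let mZ i : measurable_fun setT (Z i).
Proof. by case: mdl. Qed.

Let mX i : measurable_fun setT (X i).
Proof. by case: mdl => _ []. Qed.

Let FXE i x : P [set t | X i t <= x] = (FX x)%:E.
Proof. by case: mdl => _ [_ [_ [_ [_ [h _]]]]]. Qed.

Let cFX : continuous FX.
Proof. by case: mdl => _ [_ [_ [h _]]]. Qed.

Lemma p_success_le k m alpha : (k <= m)%N ->
  (p_success P k Z X FX alpha <= p_success P m Z X FX alpha)%E.
Proof.
move=> km; apply: le_measure; rewrite ?inE; try exact: measurable_success_event.
by move=> t [i [ik ix]]; exists i; split => //; exact: leq_trans km.
Qed.

(* If [U] is the minimum of [n] standard normal variables and [V] an independent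
   one, the hypothesis on [mu] and [sg] compares the law of [U] with N(mu, sg^2);
   integrating first over [U] and then over [V] transfers this to the law of
   [rho * U + sqrt (1 - rho^2) * V], which is that of [X_<1>]. *)
Lemma Phi_le_success (mu sg xs b : R) : (0 < n)%N -> 0 < sg ->
  Phi_inv (FX xs) = b%:E ->
  (forall c, Phi ((c - mu) / sg) <= 1 - (1 - Phi c) ^+ n) ->
  ((Phi ((b - rho * mu) / Num.sqrt (1 - rho ^+ 2 + rho ^+ 2 * sg ^+ 2)))%:E <=
    P (success_event 1 Z X xs%:E))%E.
Proof.
have /andP[rho0 rho1] := rho01.
move=> n0 sg0 xsb dom; apply/lee_addgt0Pr => e e0.
case: n n0 Z X mdl dom => // m _ Z' X' mdl' dom.
pose N : R := 3 * m.+1%:R ^+ 2.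
(* The grid is fine enough for the Riemann error N / (K + 2) to be at most e. *)
pose K := truncn (N / e).
have KN : N / K.+2%:R <= e.
  rewrite ler_pdivrMr ?ltr0n// mulrC -ler_pdivrMr//.
  rewrite (le_trans (ltW (truncnS_gt _)))// ler_nat.
  exact: leqnSn.
have [u [uP uS uE]] := riemann_sum_le_success mdl' xsb K.
pose s := Num.sqrt (1 - rho ^+ 2).
(* Given V = v, the event X <= b is U <= c v; the hypothesis [dom] is used at this point. *)
pose c v := (b - s * v) / rho.
pose w (j : 'I_K) : R := m.+1%:R * (1 - j.+2%:R / K.+2%:R) ^+ m.
pose C (j : 'I_K) := cell rho b (u j) (u j.+1).
have w0 j : 0 <= w j.
  rewrite mulr_ge0// exprn_ge0// subr_ge0 ler_pdivrMr ?ltr0n// mul1r ler_nat.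
  by rewrite !ltnS ltnW.
have s2 : s ^+ 2 = 1 - rho ^+ 2.
  by rewrite sqr_sqrtr// subr_ge0 expr_le1// ltW.
have -> : 1 - rho ^+ 2 + rho ^+ 2 * sg ^+ 2 = (rho * sg) ^+ 2 + s ^+ 2.
  by rewrite s2 exprMn addrC.
rewrite -integral_Phi_affine ?mulr_gt0//.
have mC j : measurable (C j) by exact: measurable_cell.
have my j : measurable_fun setT (fun v => gam (ysection (C j) v)).
  exact: (@measurable_fun_ysection _ _ (measurableTypeR R) (measurableTypeR R) R gam _ (mC j)).
have mg j : measurable_fun setT (fun v => (w j)%:E * gam (ysection (C j) v))%E.
  exact: emeasurable_funM.
have g0 j v : (0 <= (w j)%:E * gam (ysection (C j) v))%E.
  by rewrite mule_ge0// lee_fin.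
apply: (@le_trans _ _ (\int[gam]_v (\sum_(j < K) (w j)%:E * gam (ysection (C j) v) + e%:E))%E).
  apply: ge0_le_integral => //.
  - by move=> v _; rewrite lee_fin Phi_ge0.
  - apply/measurable_EFinP; apply: measurableT_comp; first exact: measurable_Phi.
    by apply: measurable_funM => //; exact: measurable_funB.
  - apply: emeasurable_funD => //; exact: emeasurable_sum.
  - move=> v _.
    have -> : (b - rho * mu - s * v) / (rho * sg) = (c v - mu) / sg.
      by rewrite /c; field; rewrite !gt_eqF.
    rewrite (eq_bigr (fun j : 'I_K => (w j * (minr (j.+2%:R / K.+2%:R) (Phi (c v)) -
        minr (j.+1%:R / K.+2%:R) (Phi (c v))))%:E)); last first.
      move=> j _; rewrite EFinM /C gam_ysection_cell ?uS//.
      by rewrite (uP j.+1)// (uP j)// ltnW.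
    rewrite sumEFin -EFinD lee_fin (le_trans (dom _))//.
    apply: (le_trans (cdf_min_le_riemann_sum m K (q := Phi (c v)) _)).
      by rewrite Phi_ge0 Phi_le1.
    by rewrite lerD2l.
rewrite ge0_integralD//; last 3 first.
- by move=> v _; apply: sume_ge0 => j _; exact: g0.
- exact: emeasurable_sum.
- by move=> v _; rewrite lee_fin ltW.
rewrite integral_cst//= probability_setT mule1 leeD2r//.
apply: le_trans uE; rewrite ge0_integral_sum//.
apply: lee_sum => j _; rewrite -/(w j) -/(C j) (product_measure_ysection (mC j)).
rewrite (ge0_integralZl gam measurableT (my j) (fun v _ => measure_ge0 gam _))//.
by rewrite lee_fin.
Qed.

(** Since the quantile at 1 may be infinite, the normal scale is avoided: by independence all
    X-values lie below it with probability 1, in particular the one of rank 0. *)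
Lemma p_success1 : (0 < n)%N -> (1 <= p_success P 1 Z X FX 1)%E.
Proof.
move=> n0; set q := quantile FX 1.
have mq : measurable [set x : R | (x%:E <= q)%E].
  have mE : measurable_fun setT (@EFin R) by exact/measurable_EFinP.
  by have := mE measurableT _ (emeasurable_itv `]-oo, q]); rewrite setTI.
have indep := mdl.2.2.2.2.2.2.2.
have := indep (fun _ => setT) (fun _ => [set x : R | (x%:E <= q)%E])
  (fun _ => measurableT) (fun _ => mq).
set A := \bigcap_(i in _) _ => PA.
apply: (@le_trans _ _ (P A)).
  rewrite PA; apply: (big_ind (fun x => 1 <= x)%E) => //.
    by move=> x y x1 y1; rewrite -[leLHS]mule1 lee_pmul.
  move=> i _.
  have -> : [set t | [set: R] (Z i t) /\ [set x | (x%:E <= q)%E] (X i t)] =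
      [set t | ((X i t)%:E <= q)%E].
    by apply/seteqP; split => t /=; [case|split].
  exact: (prob_le_quantile1 (mX i) cFX (FXE i)).
apply: le_measure; rewrite ?inE; last 2 first.
- exact: measurable_success_event.
- move=> t At; have [i ri] := exists_rank_eq0 (fun j => Z j t) n0.
  by exists i; split; [rewrite ri|case: (At i I)].
apply: fin_bigcap_measurable => [|i _]; first exact: finite_finset.
have := mX i measurableT mq; rewrite setTI; congr measurable.
by apply/seteqP; split => t /=; [split|case].
Qed.

Lemma bound_le_p_success theta alpha : (0 < n)%N -> 0 < alpha <= 1 ->
  0 < sigma2_n n theta ->
  (forall c, Phi ((c - mu_n n theta) / Num.sqrt (sigma2_n n theta)) <=
             1 - (1 - Phi c) ^+ n) ->
  (bound n theta alpha rho <= p_success P 1 Z X FX alpha)%E.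
Proof.
move=> n0 /andP[a0 a1] s0 dom.
(* For alpha = 1 the success probability is already 1, which bounds every value of [PhiE]. *)
move: a1; rewrite le_eqVlt => /predU1P[->|a1].
  apply: le_trans (p_success1 n0); rewrite /bound /PhiE.
  set q := (_ * _)%E; apply: (probability_le1 gam).
  have mE : measurable_fun setT (@EFin R) by exact/measurable_EFinP.
  by have := mE measurableT _ (emeasurable_itv `]-oo, q]); rewrite setTI.
have a01 : 0 < alpha < 1 by rewrite a0.
have [xs [qxs Fxs]] := quantile_continuous_cdf (mX (Ordinal n0)) cFX (FXE (Ordinal n0)) a01.
have [b [bE _]] := quantile_Phi a01.
rewrite /p_success qxs /bound bE -EFinB -EFinM PhiE_EFin.
rewrite -{1}(sqr_sqrtr (ltW s0)).
by apply: Phi_le_success; rewrite ?sqrtr_gt0// Fxs.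
Qed.

End lower_bound.

Theorem mainTheorem7 (R : realType) :
  (* (1) *)
  (forall theta : R, 0 < theta < pi / 2 -> exists nstar : nat, good theta nstar) /\
  (* (2) *)
  (forall (n m : nat), (1 <= m <= n)%N ->
   forall rho alpha : R, 0 < rho <= 1 -> 0 < alpha <= 1 ->
   forall (d : measure_display) (T : measurableType d) (P : probability T R)
          (Z X : 'I_n -> T -> R) (FZ FX : R -> R),
   gauss_copula_model P Z X FZ FX rho ->
   (p_success P 1 Z X FX alpha <= p_success P m Z X FX alpha)%E /\
   (ereal_sup [set bound n theta alpha rho | theta in @Theta_n R n]
      <= p_success P 1 Z X FX alpha)%E).
Proof.
split=> [theta th|n m mn rho alpha rho01 a01 d T P Z X FZ FX mdl].
  have [N NP] := Phi_le_cdf_min_near th.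
  exists N => n Nn m /andP[m1 _] rho alpha rho01 a01 d T P Z X FZ FX mdl.
  have [n1 s0 dom] := NP n Nn.
  split; first exact: (p_success_le mdl).
  by apply: (bound_le_p_success mdl) => //; exact: ltnW.
have /andP[m1 _] := mn.
split; first exact: (p_success_le mdl).
apply: ge_ereal_sup => _ [theta [_ [ns [ns_good _ nsn]]] <-].
exact: (ns_good n nsn m mn rho alpha rho01 a01 _ _ P Z X FZ FX mdl).2.
Qed.
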